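(* Let $k \ge 1$ and $m \in \{4k+3, 4k+5\}$, $\theta = 2\pi/m$. Then the $\theta_m$-graph on any finite point set in general position is a $\dfrac{\cos(\theta/4)}{\cos(\theta/2) - \sin(3\theta/4)}$-spanner.
   Context: Cones: for $m \ge 2$, $\theta = 2\pi/m$; around each point $u$ draw $m$ rays with consecutive angular separation $\theta$, oriented so the vertical upward ray from $u$ bisects a cone $C_0^u$; cones numbered clockwise, same orientation at every point. General position: no two points on a line parallel to a cone boundary ray, no two on a line perpendicular to a cone bisector, no three collinear. The $\theta_m$-graph on $P$: for each $u\in P$ and each cone $C_i^u$ containing another point of $P$, add an edge from $u$ to the point of $C_i^u$ whose orthogonal projection onto the bisector of $C_i^u$ is closest to $u$; edges weighted by Euclidean length. A graph $H$ on $P$ is a $t$-spanner if $\delta_H(u,w)\le t|uw|$ for all $u,w\in P$. *)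

(* Defs.v *)
From Stdlib Require Import Reals Lra Lia List.
Open Scope R_scope.

Definition point : Type := (R * R)%type.

Definition sub (a b : point) : point := (fst a - fst b, snd a - snd b).
Definition dot (a b : point) : R := fst a * fst b + snd a * snd b.
Definition cross (a b : point) : R := fst a * snd b - snd a * fst b.
Definition norm (a : point) : R := sqrt (dot a a).
Definition dist (u w : point) : R := norm (sub w u).

Definition theta (m : nat) : R := 2 * PI / INR m.

(* Unit bisector of cone C_i: angle i*theta measured clockwise from the
   vertical upward direction (C_0 is bisected by the upward ray). *)
Definition bisector (m i : nat) : point :=
  (sin (INR i * theta m), cos (INR i * theta m)).

(* Boundary ray directions: clockwise angles (i + 1/2) theta from upward,
   i = 0..m-1 (these are all m rays). *)
Definition boundary (m i : nat) : point :=
  (sin ((INR i + /2) * theta m), cos ((INR i + /2) * theta m)).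

(* w lies in cone C_i^u: w <> u and the angle between w - u and the bisector
   of C_i is at most theta/2 (closed cone; boundaries never contain points
   under general position). *)
Definition in_cone (m i : nat) (u w : point) : Prop :=
  w <> u /\ dot (sub w u) (bisector m i) >= norm (sub w u) * cos (theta m / 2).

Definition proj (m i : nat) (u w : point) : R := dot (sub w u) (bisector m i).

Definition general_position (m : nat) (P : list point) : Prop :=
  (forall u w, In u P -> In w P -> u <> w ->
     forall i, (i < m)%nat -> cross (sub w u) (boundary m i) <> 0) /\
  (forall u w, In u P -> In w P -> u <> w ->
     forall i, (i < m)%nat -> dot (sub w u) (bisector m i) <> 0) /\
  (forall u v w, In u P -> In v P -> In w P -> u <> v -> v <> w -> u <> w ->
     cross (sub v u) (sub w u) <> 0).

Definition theta_edge (m : nat) (P : list point) (u w : point) : Prop :=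
  In u P /\ In w P /\
  exists i, (i < m)%nat /\ in_cone m i u w /\
    forall w', In w' P -> in_cone m i u w' -> proj m i u w <= proj m i u w'.

Definition theta_graph (m : nat) (P : list point) (u w : point) : Prop :=
  theta_edge m P u w \/ theta_edge m P w u.

Fixpoint walk (E : point -> point -> Prop) (u : point) (l : list point) : Prop :=
  match l with
  | nil => True
  | v :: l' => E u v /\ walk E v l'
  end.

Fixpoint walk_len (u : point) (l : list point) : R :=
  match l with
  | nil => 0
  | v :: l' => dist u v + walk_len v l'
  end.

Definition is_spanner (t : R) (P : list point) (E : point -> point -> Prop) : Prop :=
  forall u w, In u P -> In w P ->
    exists l, walk E u l /\ last l u = w /\ walk_len u l <= t * dist u w.

(* Main.v *)
(** Let [t] be the claimed ratio.  For [w] in the cone [C_i^u], let [x] and [y]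
    be the coordinates of [w - u] across and along the bisector; the corner [a]
    of the canonical triangle of [u] and [w] that is farther from [w] gives the bound
    [|ua| + t |aw| = y / cos(theta/2) + t (|x| + y tan(theta/2))].
    By induction on [|uw|] some path from [u] to [w] respects this bound.
    Let [v] be the neighbour of [u] in the cone; by the triangle inequality it
    is enough to reach [w] from [v] within the same linear expression in [w - v].
    If [w] lies in [C_i^v] this is the induction hypothesis.  Otherwise it
    follows from the bound [t |vw|]: the constant [t] is chosen such that the
    linear expression equals [t |w - v|] at the angles [theta/4] and [pi/2] from
    the bisector, and hence it is at least [t |w - v|] in between.
    Finally the corner bound is at most [t |uw|] when the angle with
    the bisector is at most [theta/4]; since [m] is odd, opposite rays of
    bisectors are boundary rays, and thus this holds either from [u] or from [w]. *)
From Stdlib Require Import Reals Lra Lia List Classical ZArith.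
Require Import Defs.
Open Scope R_scope.

(** * Minimisation and induction over a finite list *)

(** Serves twice: to find a minimal counterexample in the induction below, and to find the neighbour
    of a point in a nonempty cone. *)
Lemma exists_argmin (A : Type) (f : A -> R) (Q : A -> Prop) (l : list A) :
  (exists x, In x l /\ Q x) ->
  exists x, In x l /\ Q x /\ forall y, In y l -> Q y -> f x <= f y.
Proof.
  induction l as [|a l IH]; intros [x [Hx Qx]]; [destruct Hx|].
  destruct (classic (exists z, In z l /\ Q z)) as [He|He].
  - destruct (IH He) as [z [Hz [Qz Hmin]]].
    destruct (classic (Q a /\ f a < f z)) as [[Qa Hlt]|Hn].
    + exists a; split; [now left|split; [exact Qa|]].
      intros y [->|Hy] Qy; [lra|]. specialize (Hmin y Hy Qy); lra.
    + exists z; split; [now right|split; [exact Qz|]].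
      intros y [->|Hy] Qy; [|now apply Hmin].
      apply Rnot_lt_le; intro; apply Hn; now split.
  - destruct Hx as [->|Hx]; [|exfalso; apply He; now exists x].
    exists x; split; [now left|split; [exact Qx|]].
    intros y [->|Hy] Qy; [lra|exfalso; apply He; now exists y].
Qed.

(** The order on the reals is not well-founded, but among finitely many counterexamples one has
    least [f], and the step refutes that one. *)
Lemma finite_real_induction (A : Type) (f : A -> R) (Q : A -> Prop) (l : list A) :
  (forall x, In x l -> (forall y, In y l -> f y < f x -> Q y) -> Q x) ->
  forall x, In x l -> Q x.
Proof.
  intros Hstep x Hx. apply NNPP; intro HQ.
  destruct (exists_argmin A f (fun z => ~ Q z) l) as [z [Hz [Qz Hmin]]];
    [now exists x|].
  apply Qz, Hstep; [exact Hz|].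
  intros y Hy Hlt. apply NNPP; intro Qy. specialize (Hmin y Hy Qy); lra.
Qed.

(** * Paths of bounded length *)

(** Bounding some walk replaces the graph distance, so no shortest path has to be constructed. At
    [d = t * dist u w] this is the body of [is_spanner]. *)
Definition connected_within (E : point -> point -> Prop) (d : R) (u w : point) : Prop :=
  exists l, walk E u l /\ last l u = w /\ walk_len u l <= d.

Lemma connected_within_le E d d' u w :
  d <= d' -> connected_within E d u w -> connected_within E d' u w.
Proof. intros Hd [l [H1 [H2 H3]]]. exists l; repeat split; auto; lra. Qed.

Lemma connected_within_refl E u : connected_within E 0 u u.
Proof. exists nil; simpl; repeat split; auto; lra. Qed.

(** The endpoint of a walk is [last l u], with its start as default, so that the empty list is a
    walk from [u] to [u]. Peeling off the first vertex moves the default to that vertex. *)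
Lemma last_cons_default (A : Type) (l : list A) (a d : A) :
  last (a :: l) d = last l a.
Proof.
  revert a d; induction l as [|b l IH]; intros a d; [reflexivity|].
  change (last (b :: l) d = last (b :: l) a). now rewrite !IH.
Qed.

Lemma connected_within_cons E d u v w :
  E u v -> connected_within E d v w -> connected_within E (dist u v + d) u w.
Proof.
  intros Huv [l [H1 [H2 H3]]]. exists (v :: l).
  rewrite last_cons_default; simpl; repeat split; auto; lra.
Qed.

Lemma connected_within_snoc E d u v w :
  connected_within E d u v -> E v w -> connected_within E (d + dist v w) u w.
Proof.
  intros [l [H1 [H2 H3]]] Hvw.
  exists (l ++ w :: nil). split; [|split].
  - clear H3; revert u H1 H2; induction l as [|a l IH]; intros u H1 H2.
    + simpl in *; subst; auto.
    + rewrite last_cons_default in H2. simpl in *.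
      destruct H1 as [Ha Hl]; split; [exact Ha|].
      exact (IH a Hl H2).
  - apply last_last.
  - apply Rle_trans with (walk_len u l + dist v w); [|lra].
    clear H1 H3. revert u H2; induction l as [|a l IH]; intros u H2.
    + simpl in *; subst; lra.
    + rewrite last_cons_default in H2. simpl. specialize (IH a H2); lra.
Qed.

Lemma dist_sym u w : dist u w = dist w u.
Proof.
  unfold dist, norm; f_equal.
  destruct u, w; unfold dot, sub; simpl; ring.
Qed.

Lemma connected_within_sym (E : point -> point -> Prop) d u w :
  (forall a b, E a b -> E b a) ->
  connected_within E d u w -> connected_within E d w u.
Proof.
  intros Hsym [l [H1 [H2 H3]]].
  apply connected_within_le with (walk_len u l); [exact H3|clear H3].
  revert u H1 H2; induction l as [|a l IH]; intros u H1 H2.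
  - simpl in *; subst. apply connected_within_refl.
  - rewrite last_cons_default in H2. destruct H1 as [Ha Hl].
    apply connected_within_le with (walk_len a l + dist a u).
    + simpl; rewrite (dist_sym a u); lra.
    + apply connected_within_snoc; auto.
Qed.

(** * The norm in an orthonormal frame *)

Lemma norm_nonneg z : 0 <= norm z.
Proof. apply sqrt_pos. Qed.

Lemma norm_sqr z : norm z * norm z = fst z * fst z + snd z * snd z.
Proof. apply sqrt_sqrt; unfold dot; nra. Qed.

(** Lagrange's identity for [z] and the unit vector [b]: [cross] and [dot] with a bisector are
    coordinates across and along it. *)
Lemma norm_sqr_frame z b :
  dot b b = 1 -> norm z * norm z = cross z b * cross z b + dot z b * dot z b.
Proof.
  intros Hb. rewrite norm_sqr.
  transitivity ((fst z * fst z + snd z * snd z) * dot b b); [rewrite Hb; ring|].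
  unfold dot, cross; ring.
Qed.

Lemma norm_pos u w : w <> u -> 0 < norm (sub w u).
Proof.
  intros Hne. destruct (norm_nonneg (sub w u)) as [|H0]; [assumption|exfalso].
  apply Hne. pose proof (norm_sqr (sub w u)) as Hs. rewrite <- H0 in Hs.
  destruct u as [a b], w as [c d]; simpl in Hs.
  assert (c - a = 0 /\ d - b = 0) as [? ?]; [|f_equal; lra].
  apply Rplus_sqr_eq_0; unfold Rsqr; lra.
Qed.

(** * Planar inequalities across and along a bisector *)

(** The linear form on the right takes the same value [t * C] at the unit vectors [(1, 0)] and
    [(s, K)]. On the cone they span it is [t * C] times the sum of the coefficients, which is at
    least [r] by the triangle inequality. *)
Lemma far_direction_bound C S K s t X Y r :
  0 < K -> s <= 1 -> 0 <= C -> 0 <= t -> K * K + s * s = 1 ->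
  K + t * (C * s + S * K) = t * C ->
  0 <= Y -> Y * s <= X * K -> 0 <= r -> r * r = X * X + Y * Y ->
  t * C * r <= Y + t * (C * X + S * Y).
Proof.
  intros HK Hs HC Ht HKs Hkey HY HXY Hr Hrr.
  (* [(X, Y) = lam (1, 0) + mu (s, K)], and equality holds at both vectors *)
  set (mu := Y / K). set (lam := X - mu * s).
  assert (HYm : Y = mu * K) by (unfold mu; field; lra).
  assert (Hmu : 0 <= mu).
  { unfold mu; apply Rmult_le_pos; [lra|]. left; now apply Rinv_0_lt_compat. }
  assert (Hlam : 0 <= lam) by (unfold lam; nra).
  assert (HXl : X = lam + mu * s) by (unfold lam; ring).
  assert (Hle : r <= lam + mu).
  { assert (Hrr' : r * r = lam * lam + 2 * (lam * mu) * s + mu * mu).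
    { rewrite Hrr, HXl, HYm.
      replace (mu * mu) with (mu * mu * (K * K + s * s)) by (rewrite HKs; ring).
      ring. }
    assert (0 <= lam * mu) by (now apply Rmult_le_pos).
    apply Rsqr_incr_0_var; unfold Rsqr; nra. }
  replace (Y + t * (C * X + S * Y)) with (t * C * lam + mu * (t * C))
    by (rewrite <- Hkey at 2; rewrite HXl, HYm; ring).
  assert (0 <= t * C) by (now apply Rmult_le_pos). nra.
Qed.

(** The form is [t * C] at [(s, K)] and, by the slope hypothesis, nonpositive at the orthogonal
    vector [(-K, s)]. Turning from [(s, K)] towards the bisector therefore cannot raise it above
    [t * C * r]. *)
Lemma near_direction_bound C S K s t X Y r :
  0 <= C -> 0 <= t -> K * K + s * s = 1 ->
  K + t * (C * s + S * K) = t * C -> s <= t * (C * K - S * s) ->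
  X * K <= Y * s -> 0 <= r -> r * r = X * X + Y * Y ->
  Y + t * (C * X + S * Y) <= t * C * r.
Proof.
  intros HC Ht HKs Hkey Hder HXY Hr Hrr.
  (* Coordinates in the rotated orthonormal frame [(s, K)], [(-K, s)]. *)
  set (a := X * s + Y * K). set (b := Y * s - X * K).
  assert (HX : X = a * s - b * K).
  { transitivity (X * (K * K + s * s)); [rewrite HKs; ring|unfold a, b; ring]. }
  assert (HY : Y = a * K + b * s).
  { transitivity (Y * (K * K + s * s)); [rewrite HKs; ring|unfold a, b; ring]. }
  assert (Ha : a <= r).
  { assert (r * r = a * a + b * b).
    { rewrite Hrr.
      transitivity ((X * X + Y * Y) * (K * K + s * s)); [rewrite HKs; ring|].
      unfold a, b; ring. }
    destruct (Rle_or_lt a r); nra. }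
  assert (Hb : 0 <= b) by (unfold b; lra).
  replace (Y + t * (C * X + S * Y))
    with (a * (t * C) + b * (s - t * (C * K - S * s)))
    by (rewrite <- Hkey; rewrite HX, HY; ring).
  assert (0 <= t * C) by (now apply Rmult_le_pos). nra.
Qed.

(** The triangle inequality through a corner of the canonical triangle, scaled by [C]: the sides at
    the corner have scaled lengths [q] and [C * p + S * q]. *)
Lemma hypotenuse_bound C S t p q r :
  0 <= q -> 0 <= S -> 0 < C -> C * C + S * S = 1 -> 1 <= t -> 0 <= C * p + S * q ->
  0 <= r -> r * r = p * p + q * q ->
  C * r <= q + t * (C * p + S * q).
Proof.
  intros Hq HS HC HCS Ht Hs Hr Hrr.
  set (a := C * p + S * q) in *.
  apply Rle_trans with (q + a); [|nra].
  (* Law of cosines at the corner, where the angle has cosine [S]. *)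
  assert (Hsq : (C * r) * (C * r) = a * a - 2 * (a * q) * S + q * q).
  { replace (C * r * (C * r)) with (C * C * (r * r)) by ring. rewrite Hrr.
    transitivity (C * C * (p * p) + (C * C + S * S - S * S) * (q * q)); [ring|].
    rewrite HCS. unfold a; ring. }
  assert (0 <= a * q) by (now apply Rmult_le_pos).
  apply Rsqr_incr_0_var; unfold Rsqr; nra.
Qed.

(** Passes from the cosine form to the tangent form of the same bound on the angle with the axis;
    [slope_cone] goes back. *)
Lemma cone_slope C S x y r :
  0 <= S -> 0 <= C -> C * C + S * S = 1 -> r * C <= y -> 0 <= r ->
  r * r = x * x + y * y -> x * C <= y * S.
Proof.
  intros HS HC HCS Hy Hr Hrr.
  assert (0 <= y) by nra.
  apply Rsqr_incr_0_var; [|nra]. unfold Rsqr.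
  assert ((r * C) * (r * C) <= y * y) by (apply Rmult_le_compat; nra).
  nra.
Qed.

Lemma slope_cone C S x y r :
  0 <= S -> 0 <= C -> C * C + S * S = 1 -> 0 <= x -> 0 <= y -> x * C <= y * S ->
  r * r = x * x + y * y -> r * C <= y.
Proof.
  intros HS HC HCS Hx Hy Hxy Hrr.
  apply Rsqr_incr_0_var; [|exact Hy]. unfold Rsqr.
  assert ((x * C) * (x * C) <= (y * S) * (y * S)) by (apply Rmult_le_compat; nra).
  nra.
Qed.

(** Here [(x, y)] is [w - u] and [(p, q)] is [v - u]. The cone is narrower than 60 degrees:
    [C * C * (r * r - r' * r')] is at least [q * y * (1 - 4 * (S * S))], because
    [q * q <= q * y]. *)
Lemma cone_step_closer C S x y p q r r' :
  0 < C -> C * C + S * S = 1 -> S < / 2 -> 0 <= S ->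
  - (y * S) <= x * C <= y * S -> - (q * S) <= p * C <= q * S ->
  0 < q -> q <= y -> 0 <= r -> r * r = x * x + y * y ->
  r' * r' = (x - p) * (x - p) + (y - q) * (y - q) -> r' < r.
Proof.
  intros HC HCS HS HS0 Hx Hp Hq Hqy Hr Hrr Hrr'.
  assert (H1 : (p * C) * (p * C) <= (q * S) * (q * S)) by nra.
  assert (H2 : - ((q * S) * (y * S)) <= (p * C) * (x * C)) by nra.
  assert (H3 : 4 * (S * S) < 1) by nra.
  assert (Hc : C * C = 1 - S * S) by lra.
  assert (Hqq : q * q <= q * y) by (apply Rmult_le_compat_l; lra).
  assert (Hqy0 : 0 < q * y) by (apply Rmult_lt_0_compat; lra).
  assert (H5 : (q * y) * (4 * (S * S)) < (q * y) * 1)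
    by (apply Rmult_lt_compat_l; lra).
  assert (H4 : C * C * (r' * r') < C * C * (r * r)).
  { rewrite Hrr, Hrr'.
    assert (C * C * (x * x + y * y)
            - C * C * ((x - p) * (x - p) + (y - q) * (y - q))
            = 2 * ((p * C) * (x * C)) - (p * C) * (p * C)
              + (1 - S * S) * (2 * (q * y) - q * q)) by (rewrite <- Hc; ring).
    nra. }
  apply Rmult_lt_reg_l in H4; [|now apply Rmult_lt_0_compat].
  apply Rnot_le_lt; intro Hle. clear - H4 Hr Hle. nra.
Qed.

(** * Directions and their rounding to bisectors *)

Definition direction (phi : R) : point := (sin phi, cos phi).

Lemma polar_form z : exists phi, z = (norm z * sin phi, norm z * cos phi).
Proof.
  destruct (Req_dec (norm z) 0) as [H0|H0].
  - exists 0. pose proof (norm_sqr z) as Hs. rewrite H0 in *.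
    destruct z as [a b]; simpl in Hs.
    destruct (Rplus_sqr_eq_0 a b) as [-> ->]; [unfold Rsqr; lra|f_equal; ring].
  - pose proof (norm_nonneg z). pose proof (norm_sqr z) as Hs.
    set (r := norm z) in *. destruct z as [a b]; simpl in Hs.
    assert (Hc : -1 <= b / r <= 1).
    { assert (- r <= b <= r) by (split; nra).
      split; apply Rmult_le_reg_r with r; try lra;
        unfold Rdiv; rewrite Rmult_assoc, Rinv_l by lra; lra. }
    assert (Hsq : sqrt (1 - (b / r)²) = Rabs a / r).
    { replace (1 - (b / r)²) with ((a / r)²).
      - rewrite sqrt_Rsqr_abs. unfold Rdiv. rewrite Rabs_mult, (Rabs_pos_eq (/ r)); [ring|].
        left; apply Rinv_0_lt_compat; lra.
      - unfold Rsqr. apply Rmult_eq_reg_r with (r * r); [|nra].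
        transitivity (a * a); [field; lra|].
        transitivity (r * r - b * b); [lra|field; lra]. }
    assert (Hb : b = r * cos (acos (b / r))).
    { rewrite cos_acos by lra. field; lra. }
    (* [acos] only reaches the right half-plane, so on the left the angle is negated. *)
    destruct (Rle_or_lt 0 a) as [Ha|Ha].
    + exists (acos (b / r)). f_equal; [|exact Hb].
      rewrite sin_acos, Hsq, Rabs_pos_eq by lra. field; lra.
    + exists (- acos (b / r)). rewrite sin_neg, cos_neg. f_equal; [|exact Hb].
      rewrite sin_acos, Hsq, Rabs_left by lra. field; lra.
Qed.

Lemma nearest_multiple phi d :
  0 < d -> exists n : Z, Rabs (phi - IZR n * d) <= d / 2.
Proof.
  intros Hd. exists (up (phi / d - / 2)).
  destruct (archimed (phi / d - / 2)) as [H1 H2].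
  set (n := IZR (up _)) in *.
  assert (He : phi - n * d = (phi / d - n) * d) by (field; lra).
  rewrite He. apply Rabs_le. nra.
Qed.

Lemma direction_period phi (q : Z) :
  direction (phi + IZR q * (2 * PI)) = direction phi.
Proof.
  assert (Hnat : forall psi n, direction (psi + INR n * (2 * PI)) = direction psi).
  { intros psi n. unfold direction.
    replace (psi + INR n * (2 * PI)) with (psi + 2 * INR n * PI) by ring.
    now rewrite sin_period, cos_period. }
  destruct (Z_le_gt_dec 0 q).
  - rewrite <- (Z2Nat.id q) by lia. rewrite <- INR_IZR_INZ. apply Hnat.
  - rewrite <- (Hnat (phi + IZR q * (2 * PI)) (Z.to_nat (- q))). f_equal.
    rewrite INR_IZR_INZ, Z2Nat.id, opp_IZR by lia. ring.
Qed.

(** Since [m * theta m] is a full turn, [j] may be reduced modulo [m] to a genuine cone index. *)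
Lemma bisector_direction m (j : Z) :
  (0 < m)%nat ->
  exists i, (i < m)%nat /\ direction (IZR j * theta m) = bisector m i.
Proof.
  intros Hm. exists (Z.to_nat (j mod Z.of_nat m)).
  pose proof (Z.mod_pos_bound j (Z.of_nat m) ltac:(lia)) as Hb.
  assert (HmR : INR m <> 0) by (apply not_0_INR; lia).
  split; [lia|].
  rewrite (Z.div_mod j (Z.of_nat m)) at 1 by lia.
  rewrite plus_IZR, mult_IZR, <- INR_IZR_INZ.
  replace ((INR m * IZR (j / Z.of_nat m) + IZR (j mod Z.of_nat m)) * theta m)
    with (IZR (j mod Z.of_nat m) * theta m + IZR (j / Z.of_nat m) * (2 * PI))
    by (unfold theta; field; exact HmR).
  rewrite direction_period. unfold bisector, direction.
  now rewrite INR_IZR_INZ, Z2Nat.id by lia.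
Qed.

(** Every direction is within [theta / 4] of a multiple of [theta / 2]. Even multiples are bisectors
    and, as [m] is odd, odd multiples are opposite to bisectors; the absolute value covers both. *)
Lemma narrow_cone m z :
  Nat.Odd m ->
  exists i, (i < m)%nat /\
    norm z * cos (theta m / 4) <= Rabs (dot z (bisector m i)).
Proof.
  intros [k Hk].
  assert (Hm : 0 < INR m) by (apply lt_0_INR; lia).
  pose proof PI_RGT_0 as HPI.
  assert (Hth : 0 < theta m).
  { unfold theta, Rdiv. apply Rmult_lt_0_compat; [lra|now apply Rinv_0_lt_compat]. }
  assert (Hle : theta m / 4 <= PI).
  { unfold theta. assert (1 <= INR m) by (apply (le_INR 1); lia).
    apply Rmult_le_reg_r with (INR m); [lra|].
    replace (2 * PI / INR m / 4 * INR m) with (PI / 2) by (field; lra). nra. }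
  destruct (polar_form z) as [phi Hz].
  destruct (nearest_multiple phi (theta m / 2)) as [n Hn]; [lra|].
  assert (Hdot : norm z * cos (theta m / 4)
                 <= dot z (direction (IZR n * (theta m / 2)))).
  { rewrite Hz at 2. unfold dot, direction; simpl.
    set (psi := IZR n * (theta m / 2)) in *.
    replace (norm z * sin phi * sin psi + norm z * cos phi * cos psi)
      with (norm z * cos (phi - psi)) by (rewrite cos_minus; ring).
    apply Rmult_le_compat_l; [apply norm_nonneg|].
    assert (Hcabs : cos (phi - psi) = cos (Rabs (phi - psi))).
    { unfold Rabs; destruct (Rcase_abs (phi - psi)); [now rewrite cos_neg|reflexivity]. }
    rewrite Hcabs. pose proof (Rabs_pos (phi - psi)).
    apply cos_decr_1; lra. }
  destruct (Z.Even_or_Odd n) as [[j Hj]|[j Hj]].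
  - destruct (bisector_direction m j) as [i [Hi Hb]]; [lia|].
    exists i; split; [exact Hi|]. rewrite <- Hb.
    replace (IZR j * theta m) with (IZR n * (theta m / 2))
      by (rewrite Hj, mult_IZR; field).
    pose proof (Rle_abs (dot z (direction (IZR n * (theta m / 2))))). lra.
  - (* [2 j + 1 = 2 (j - k) + m], and [m theta / 2 = pi] *)
    destruct (bisector_direction m (j - Z.of_nat k)) as [i [Hi Hb]]; [lia|].
    exists i; split; [exact Hi|]. rewrite <- Hb.
    assert (He : IZR n * (theta m / 2) = IZR (j - Z.of_nat k) * theta m + PI).
    { replace PI with (INR m * (theta m / 2)) at 1 by (unfold theta; field; lra).
      rewrite Hj, Hk, plus_INR, mult_INR, plus_IZR, mult_IZR, minus_IZR.
      rewrite <- INR_IZR_INZ. simpl (INR 1). simpl (INR 2). field. }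
    rewrite He in Hdot. set (psi := IZR (j - Z.of_nat k) * theta m) in *.
    unfold direction in Hdot. rewrite neg_sin, neg_cos in Hdot.
    apply Rle_trans with (1 := Hdot).
    rewrite <- Rabs_Ropp.
    apply Rle_trans with (2 := Rle_abs _).
    unfold dot, direction; simpl; lra.
Qed.

Lemma bisector_unit m i : dot (bisector m i) (bisector m i) = 1.
Proof.
  unfold dot, bisector; simpl.
  pose proof (sin2_cos2 (INR i * theta m)); unfold Rsqr in *; lra.
Qed.

(** * The corner bound and the spanning ratio *)

(** The length [|ua| + t |aw|] for [z = w - u], over the common denominator [cos (theta / 2)]. *)
Definition corner_bound (t : R) (m i : nat) (z : point) : R :=
  (dot z (bisector m i)
   + t * (cos (theta m / 2) * Rabs (cross z (bisector m i))
          + sin (theta m / 2) * dot z (bisector m i))) / cos (theta m / 2).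

Definition spanning_ratio (m : nat) : R :=
  cos (theta m / 4) / (cos (theta m / 2) - sin (3 * theta m / 4)).

(** The algebraic interface to the trigonometry: [C], [S] belong to the angle [theta / 2] and [K],
    [s] to [theta / 4]. [rf_key] is the equation defining [t], with [sin (3 * theta / 4)] expanded;
    [rf_slope] makes the linear form decrease towards the bisector. *)
Record ratio_facts (C S K s t : R) : Prop := {
  rf_C : 0 < C; rf_S : 0 < S; rf_S_half : S < / 2; rf_CS : C * C + S * S = 1;
  rf_K : 0 < K; rf_s : 0 < s; rf_Ks : K * K + s * s = 1;
  rf_quarter : C * s <= S * K;
  rf_t : 1 <= t;
  rf_key : K + t * (C * s + S * K) = t * C;
  rf_slope : s <= t * (C * K - S * s)
}.

Lemma spanning_ratio_facts m :
  (7 <= m)%nat ->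
  ratio_facts (cos (theta m / 2)) (sin (theta m / 2))
    (cos (theta m / 4)) (sin (theta m / 4)) (spanning_ratio m).
Proof.
  intros Hm.
  assert (HmR : 7 <= INR m) by (replace 7 with (INR 7) by (simpl; lra); now apply le_INR).
  pose proof PI_RGT_0 as HPI.
  assert (Hth : 0 < theta m).
  { unfold theta, Rdiv. apply Rmult_lt_0_compat; [lra|apply Rinv_0_lt_compat; lra]. }
  assert (Hub : theta m <= 2 * PI / 7).
  { unfold theta, Rdiv. apply Rmult_le_compat_l; [lra|]. apply Rinv_le_contravar; lra. }
  unfold spanning_ratio. set (th := theta m) in *. clearbody th.
  assert (H3 : sin (3 * th / 4) = cos (th / 2) * sin (th / 4) + sin (th / 2) * cos (th / 4)).
  { replace (3 * th / 4) with (th / 4 + th / 2) by field. rewrite sin_plus; ring. }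
  assert (H3c : cos (3 * th / 4) = cos (th / 2) * cos (th / 4) - sin (th / 2) * sin (th / 4)).
  { replace (3 * th / 4) with (th / 2 + th / 4) by field. apply cos_plus. }
  assert (H3pos : 0 < sin (3 * th / 4)) by (apply sin_gt_0; lra).
  (* The denominator is positive since [3 * th / 4 + th / 2 < PI / 2]. *)
  assert (Hden : sin (3 * th / 4) < cos (th / 2)).
  { rewrite <- cos_shift. apply cos_decreasing_1; lra. }
  assert (HKC : cos (th / 2) <= cos (th / 4)) by (apply cos_decr_1; lra).
  set (t := cos (th / 4) / (cos (th / 2) - sin (3 * th / 4))).
  assert (Ht : t * (cos (th / 2) - sin (3 * th / 4)) = cos (th / 4)).
  { unfold t; field; lra. }
  assert (Hs : 0 < sin (th / 4)) by (apply sin_gt_0; lra).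
  assert (Ht1 : 1 <= t).
  { destruct (Rle_or_lt 1 t); [assumption|exfalso]. nra. }
  pose proof (sin2_cos2 (th / 2)) as E2. pose proof (sin2_cos2 (th / 4)) as E4.
  unfold Rsqr in E2, E4.
  constructor.
  - apply cos_gt_0; lra.
  - apply sin_gt_0; lra.
  (* This needs [th / 2 < PI / 6], which is where seven cones, and not six, are required. *)
  - replace (/ 2) with (1 / 2) by field. rewrite <- sin_PI6.
    apply sin_increasing_1; lra.
  - lra.
  - apply cos_gt_0; lra.
  - exact Hs.
  - lra.
  - replace (th / 4) with (th / 2 - th / 4) in Hs at 1 by field.
    rewrite sin_minus in Hs. lra.
  - exact Ht1.
  - rewrite <- H3. lra.
  - rewrite <- H3c.
    assert (sin (th / 4) <= cos (3 * th / 4)).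
    { rewrite <- cos_shift. apply cos_decr_1; lra. }
    nra.
Qed.

Lemma corner_bound_narrow C S K s t X Y r :
  ratio_facts C S K s t ->
  0 <= r -> r * r = X * X + Y * Y -> r * K <= Y ->
  (Y + t * (C * Rabs X + S * Y)) / C <= t * r.
Proof.
  intros [] Hr Hrr HrK.
  assert (Hrr' : r * r = Rabs X * Rabs X + Y * Y).
  { rewrite Hrr. f_equal. exact (Rsqr_abs X). }
  assert (Hsl : Rabs X * K <= Y * s) by (apply (cone_slope K s _ _ r); lra).
  apply Rmult_le_reg_r with C; [lra|].
  replace ((Y + t * (C * Rabs X + S * Y)) / C * C)
    with (Y + t * (C * Rabs X + S * Y)) by (field; lra).
  replace (t * r * C) with (t * C * r) by ring.
  apply (near_direction_bound C S K s); lra.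
Qed.

Lemma in_cone_of_narrow m i u w :
  (7 <= m)%nat -> w <> u ->
  norm (sub w u) * cos (theta m / 4) <= dot (sub w u) (bisector m i) ->
  in_cone m i u w.
Proof.
  intros Hm Hne Hd. split; [exact Hne|]. apply Rle_ge.
  destruct (spanning_ratio_facts m Hm) as [].
  pose proof (norm_pos u w Hne) as Hpos.
  assert (cos (theta m / 2) <= cos (theta m / 4)); [|nra].
  set (C := cos (theta m / 2)) in *. set (K := cos (theta m / 4)) in *.
  set (S := sin (theta m / 2)) in *. set (s := sin (theta m / 4)) in *.
  (* If [K < C], then [rf_quarter] forces [s < S], so two sums of squares that both equal 1 would
     differ. *)
  destruct (Rle_or_lt C K) as [|Hlt]; [assumption|exfalso].
  assert (s < S) by (apply Rmult_lt_reg_r with K; nra).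
  assert (K * K < C * C) by (apply Rmult_le_0_lt_compat; lra).
  assert (s * s < S * S) by (apply Rmult_le_0_lt_compat; lra).
  lra.
Qed.

Lemma dot_opp_sub u w b : dot (sub u w) b = - dot (sub w u) b.
Proof. unfold dot, sub; simpl; ring. Qed.

(** * Induction on the distance *)

(** The induction invariant. It is directed, since the corner bound seen from [u] differs from the
    one seen from [w]. *)
Definition corner_connected (m : nat) (P : list point) (u w : point) : Prop :=
  forall i, (i < m)%nat -> in_cone m i u w ->
    connected_within (theta_graph m P) (corner_bound (spanning_ratio m) m i (sub w u)) u w.

Lemma theta_graph_sym m P a b : theta_graph m P a b -> theta_graph m P b a.
Proof. unfold theta_graph; tauto. Qed.

Lemma corner_connected_ratio m P u w :
  (7 <= m)%nat -> Nat.Odd m -> w <> u ->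
  corner_connected m P u w -> corner_connected m P w u ->
  connected_within (theta_graph m P) (spanning_ratio m * dist u w) u w.
Proof.
  intros Hm Hodd Hne Huw Hwu.
  pose proof (spanning_ratio_facts m Hm) as Hf.
  destruct (narrow_cone m (sub w u) Hodd) as [i [Hi Hn]].
  assert (Hcase : forall a b, b <> a -> corner_connected m P a b ->
    norm (sub b a) * cos (theta m / 4) <= dot (sub b a) (bisector m i) ->
    connected_within (theta_graph m P) (spanning_ratio m * dist a b) a b).
  { intros a b Hab Hc Hd.
    apply connected_within_le with (2 := Hc i Hi (in_cone_of_narrow m i a b Hm Hab Hd)).
    apply (corner_bound_narrow _ _ _ _ _ _ _ _ Hf); [apply norm_nonneg| |exact Hd].
    apply norm_sqr_frame, bisector_unit. }
  destruct (Rcase_abs (dot (sub w u) (bisector m i))) as [Hneg|Hpos].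
  (* The bisector points away from [w], so [u] lies in the narrow part of the cone of [w] with the
     same index. *)
  - rewrite Rabs_left in Hn by exact Hneg.
    apply connected_within_sym; [apply theta_graph_sym|].
    rewrite dist_sym. apply Hcase; [auto|exact Hwu|].
    rewrite dot_opp_sub. change (norm (sub u w)) with (dist w u).
    rewrite dist_sym. exact Hn.
  - rewrite Rabs_right in Hn by exact Hpos. now apply Hcase.
Qed.

Lemma in_cone_coordinates C S K s t m i u w :
  ratio_facts C S K s t -> C = cos (theta m / 2) ->
  in_cone m i u w ->
  let x := cross (sub w u) (bisector m i) in
  let y := dot (sub w u) (bisector m i) in
  0 < y /\ - (y * S) <= x * C <= y * S.
Proof.
  intros [] HC [Hne Hd]. cbv zeta. rewrite <- HC in Hd.
  pose proof (norm_pos u w Hne) as Hpos.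
  pose proof (norm_sqr_frame (sub w u) _ (bisector_unit m i)) as Hrr.
  set (r := norm _) in *. set (y := dot _ _) in *. set (x := cross _ _) in *.
  assert (0 < r * C) by (now apply Rmult_lt_0_compat).
  repeat split; [lra| |].
  - assert ((- x) * C <= y * S); [|lra]. apply (cone_slope C S _ _ r); lra.
  - apply (cone_slope C S _ _ r); lra.
Qed.

(* The sign [sg] selects the side of [w] on which [v] lies. *)
Lemma connected_within_side m P i sg v w :
  (7 <= m)%nat -> Nat.Odd m -> (i < m)%nat -> (sg = 1 \/ sg = -1) ->
  let X := sg * cross (sub w v) (bisector m i) in
  let Y := dot (sub w v) (bisector m i) in
  0 <= X -> 0 <= Y ->
  (w <> v -> corner_connected m P v w /\ corner_connected m P w v) ->
  connected_within (theta_graph m P)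
    ((Y + spanning_ratio m * (cos (theta m / 2) * X + sin (theta m / 2) * Y))
     / cos (theta m / 2)) v w.
Proof.
  intros Hm Hodd Hi Hsg X Y HX HY IH.
  pose proof (spanning_ratio_facts m Hm) as Hf. pose proof Hf as [].
  destruct (classic (w = v)) as [->|Hne].
  { apply connected_within_le with 0; [|apply connected_within_refl].
    apply Rmult_le_pos; [|left; now apply Rinv_0_lt_compat].
    apply Rplus_le_le_0_compat; [exact HY|]. apply Rmult_le_pos; nra. }
  destruct (IH Hne) as [Hvw Hwv].
  assert (Habs : Rabs (cross (sub w v) (bisector m i)) = X).
  { unfold X in *. destruct Hsg as [-> | ->].
    - rewrite Rabs_pos_eq; lra.
    - rewrite Rabs_left1; lra. }
  pose proof (norm_sqr_frame (sub w v) _ (bisector_unit m i)) as Hrr.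
  assert (Hrr' : norm (sub w v) * norm (sub w v) = X * X + Y * Y).
  { rewrite Hrr. unfold X, Y. destruct Hsg as [-> | ->]; ring. }
  pose proof (norm_nonneg (sub w v)) as Hr.
  (* Either [w] lies in the cone of [v] with the same index, or its angle with the bisector is
     between [theta / 2] and [PI / 2], where the far bound applies. *)
  destruct (Rle_or_lt (X * cos (theta m / 2)) (Y * sin (theta m / 2))) as [Hin|Hout].
  - apply connected_within_le with (corner_bound (spanning_ratio m) m i (sub w v)).
    + unfold corner_bound. rewrite Habs. apply Rle_refl.
    + apply Hvw; [exact Hi|]. split; [exact Hne|]. apply Rle_ge.
      fold Y. clearbody X Y.
      apply (slope_cone _ (sin (theta m / 2)) X); lra.
  - apply connected_within_le with (spanning_ratio m * dist v w);
      [|now apply corner_connected_ratio].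
    set (C := cos (theta m / 2)) in *. set (S := sin (theta m / 2)) in *.
    set (K := cos (theta m / 4)) in *. set (s := sin (theta m / 4)) in *.
    set (t := spanning_ratio m) in *. unfold dist.
    apply Rmult_le_reg_r with C; [lra|].
    replace ((Y + t * (C * X + S * Y)) / C * C) with (Y + t * (C * X + S * Y))
      by (field; lra).
    replace (t * norm (sub w v) * C) with (t * C * norm (sub w v)) by ring.
    apply (far_direction_bound C S K s); try lra.
    + nra.
    (* By [rf_quarter], an angle beyond [theta / 2] is also beyond [theta / 4]. *)
    + apply Rmult_le_reg_r with C; [lra|].
      assert (Y * (C * s) <= Y * (S * K)) by (now apply Rmult_le_compat_l).
      assert (Y * S * K <= X * C * K) by (apply Rmult_le_compat_r; lra). lra.
Qed.

Lemma corner_connected_step m P u w :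
  (7 <= m)%nat -> Nat.Odd m -> In u P -> In w P ->
  (forall a b, In a P -> In b P -> dist a b < dist u w -> corner_connected m P a b) ->
  corner_connected m P u w.
Proof.
  intros Hm Hodd Hu Hw IH i Hi Hcone.
  pose proof (spanning_ratio_facts m Hm) as Hf. pose proof Hf as [].
  (* [v] is the neighbour of [u] in this cone; it may be [w] itself. *)
  destruct (exists_argmin point (proj m i u) (in_cone m i u) P) as [v [Hv [Hvc Hmin]]];
    [now exists w|].
  assert (Hedge : theta_graph m P u v).
  { left. split; [exact Hu|split; [exact Hv|]]. now exists i. }
  specialize (Hmin w Hw Hcone). unfold proj in Hmin.
  destruct (in_cone_coordinates _ _ _ _ _ m i u w Hf eq_refl Hcone) as [Hy Hx].
  destruct (in_cone_coordinates _ _ _ _ _ m i u v Hf eq_refl Hvc) as [Hq Hp].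
  assert (HX : cross (sub w v) (bisector m i)
     = cross (sub w u) (bisector m i) - cross (sub v u) (bisector m i))
    by (unfold cross, sub; simpl; ring).
  assert (HY : dot (sub w v) (bisector m i)
     = dot (sub w u) (bisector m i) - dot (sub v u) (bisector m i))
    by (unfold dot, sub; simpl; ring).
  pose proof (norm_sqr_frame (sub w u) _ (bisector_unit m i)) as Ruw.
  pose proof (norm_sqr_frame (sub v u) _ (bisector_unit m i)) as Ruv.
  pose proof (norm_sqr_frame (sub w v) _ (bisector_unit m i)) as Rvw.
  assert (Hcloser : dist v w < dist u w).
  { rewrite HX, HY in Rvw.
    apply (cone_step_closer _ _ _ _ _ _ _ _ rf_C0 rf_CS0 rf_S_half0
             (Rlt_le _ _ rf_S0) Hx Hp Hq Hmin (norm_nonneg _) Ruw Rvw). }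
  assert (Hsg : exists sg, (sg = 1 \/ sg = -1) /\ 0 <= sg * cross (sub w v) (bisector m i)).
  { destruct (Rle_or_lt 0 (cross (sub w v) (bisector m i))).
    - exists 1; lra.
    - exists (-1); lra. }
  destruct Hsg as [sg [Hsg HX0]].
  assert (HY0 : 0 <= dot (sub w v) (bisector m i)) by lra.
  pose proof (connected_within_side m P i sg v w Hm Hodd Hi Hsg HX0 HY0) as Hside.
  cbv zeta in Hside.
  apply connected_within_le with (2 := connected_within_cons _ _ _ _ _ Hedge
    (Hside (fun _ => conj (IH v w Hv Hw Hcloser)
      (IH w v Hw Hv (eq_ind _ (fun d => d < dist u w) Hcloser _ (dist_sym v w)))))).
  rewrite HX, HY. unfold corner_bound, dist.
  pose proof (norm_nonneg (sub v u)) as Hr.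
  clear IH Hside Hcloser HX0 HY0 Rvw Ruw HX HY.
  set (C := cos (theta m / 2)) in *. set (S := sin (theta m / 2)) in *.
  set (t := spanning_ratio m) in *.
  set (x := cross (sub w u) _) in *. set (y := dot (sub w u) _) in *.
  set (p := cross (sub v u) _) in *. set (q := dot (sub v u) _) in *.
  set (r := norm (sub v u)) in *.
  (* With the corner on the side of [v] away from [w], the bound for [w - v] and the scaled path
     through the corner to [v] add up to the bound for [w - u], apart from [sg * x <= Rabs x]. *)
  assert (Hhyp : C * r <= q + t * (C * (sg * p) + S * q)).
  { apply (hypotenuse_bound C S t); try lra; destruct Hsg as [-> | ->]; lra. }
  assert (Habs : sg * x <= Rabs x).
  { destruct Hsg as [-> | ->].
    - pose proof (Rle_abs x); lra.
    - pose proof (Rle_abs (- x)); rewrite Rabs_Ropp in *; lra. }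
  apply Rmult_le_reg_r with C; [lra|].
  assert (Ht : t * C * (sg * x) <= t * C * Rabs x).
  { apply Rmult_le_compat_l; [|exact Habs]. apply Rmult_le_pos; lra. }
  replace ((r + (y - q + t * (C * (sg * (x - p)) + S * (y - q))) / C) * C)
    with (C * r + (y - q + t * (C * (sg * (x - p)) + S * (y - q)))) by (field; lra).
  replace ((y + t * (C * Rabs x + S * y)) / C * C)
    with (y + t * (C * Rabs x + S * y)) by (field; lra).
  lra.
Qed.

Theorem mainTheorem13 (k m : nat) (P : list point) :
  (1 <= k)%nat ->
  (m = 4 * k + 3 \/ m = 4 * k + 5)%nat ->
  NoDup P ->
  general_position m P ->
  is_spanner
    (cos (theta m / 4) / (cos (theta m / 2) - sin (3 * theta m / 4)))
    P (theta_graph m P).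
Proof.
  intros Hk Hm _ _ u w Hu Hw.
  assert (Hm7 : (7 <= m)%nat) by lia.
  assert (Hodd : Nat.Odd m).
  { destruct Hm as [-> | ->]; [exists (2 * k + 1)%nat|exists (2 * k + 2)%nat]; lia. }
  assert (Hall : forall a b, In a P -> In b P -> corner_connected m P a b).
  { intros a b Ha Hb.
    (* The induction runs over ordered pairs, because the step uses both directions between [v] and
       [w]. *)
    apply (finite_real_induction (point * point) (fun ab => dist (fst ab) (snd ab))
             (fun ab => corner_connected m P (fst ab) (snd ab)) (list_prod P P))
      with (x := (a, b)); [|now apply in_prod].
    intros [c d] Hcd IH. apply in_prod_iff in Hcd as [Hc Hd].
    apply corner_connected_step; auto.
    intros e f He Hf Hlt. apply (IH (e, f)); [now apply in_prod|exact Hlt]. }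
  change (connected_within (theta_graph m P) (spanning_ratio m * dist u w) u w).
  destruct (classic (w = u)) as [->|Hne].
  - apply connected_within_le with 0; [|apply connected_within_refl].
    destruct (spanning_ratio_facts m Hm7).
    apply Rmult_le_pos; [lra|apply norm_nonneg].
  - apply corner_connected_ratio; auto.
Qed.
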